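(* For every integer $n\ge 1$, let $A_n$ (resp. $B_n$) be the number of complete non-ambiguous trees of size $n$ whose determinant is $1$ (resp. $-1$), let $T_n=A_n+B_n$ be the total number of complete non-ambiguous trees of size $n$, and let $D_n=A_n-B_n$. Then $$D_n=A_n-B_n=\begin{cases}1 & \text{if } n=1,\\ 0 & \text{if } n>1 \text{ is odd},\\ (-1)^{n/2}T_{n/2} & \text{if } n \text{ is even}.\end{cases}$$
   Context: A non-ambiguous tree is a filling of a rectangular grid in which each cell may or may not contain a dot, such that: (i) the top-left cell (the root) is dotted; (ii) for every dotted cell (vertex) other than the root, there is another vertex either in the same column and above it, or in the same row and to its left, but not both; (iii) every row and every column contains at least one vertex. Connecting each non-root vertex to its unique nearest such precursor (the closest vertex above in its column or to its left in its row, whichever exists) yields a rooted binary tree; the non-ambiguous tree is complete (a CNAT) if this binary tree is complete (every vertex has 0 or 2 children). A CNAT with $2n-1$ vertices occupies an $n\times n$ grid (exactly one leaf per row and column) and is said to have size $n$. The determinant of a CNAT is the determinant of the $n\times n$ $0/1$ matrix obtained by putting $1$ in dotted cells and $0$ in empty cells; it is always $\pm1$. *)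

(* Defs.v *)
From HB Require Import structures.
From mathcomp Require Import all_boot all_order all_algebra.
Set Implicit Arguments.
Unset Strict Implicit.
Unset Printing Implicit Defensive.
Import Order.TTheory GRing.Theory Num.Theory.
Local Open Scope ring_scope.

(* A filling of a rectangular grid with m rows and p columns is represented by
   the set of its dotted cells (i, j), where i is the row, numbered from the top,
   and j the column, numbered from the left. *)
Definition cell (m p : nat) := ('I_m * 'I_p)%type.
Definition filling (m p : nat) := {set cell m p}.

Definition is_root (m p : nat) (u : cell m p) : bool :=
  (u.1 == 0 :> nat)%N && (u.2 == 0 :> nat)%N.

Definition above (m p : nat) (u v : cell m p) : bool :=
  (u.2 == v.2) && (u.1 < v.1)%N.

Definition left_of (m p : nat) (u v : cell m p) : bool :=
  (u.1 == v.1) && (u.2 < v.2)%N.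

Definition nonambiguous (m p : nat) (T : filling m p) : bool :=
  [&& [exists u in T, is_root u],
      [forall v in T, ~~ is_root v ==>
         ([exists u in T, above u v] (+) [exists u in T, left_of u v])],
      [forall i : 'I_m, exists j : 'I_p, (i, j) \in T]
    & [forall j : 'I_p, exists i : 'I_m, (i, j) \in T]].

Definition nearest (m p : nat) (r : rel (cell m p)) (T : filling m p)
    (u v : cell m p) : bool :=
  [&& u \in T, r u v & [forall w in T, ~~ (r u w && r w v)]].

(* In a non-ambiguous tree exactly one of the two disjuncts can hold for a
   given non-root vertex v, and it determines u; none holds for the root. *)
Definition parent (m p : nat) (T : filling m p) (u v : cell m p) : bool :=
  nearest (@above m p) T u v || nearest (@left_of m p) T u v.

Definition children (m p : nat) (T : filling m p) (u : cell m p) :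
    {set cell m p} :=
  [set v in T | parent T u v].

Definition complete (m p : nat) (T : filling m p) : bool :=
  [forall u in T, (#|children T u| == 0%N) || (#|children T u| == 2%N)].

(* Complete non-ambiguous trees of size n, i.e. with 2n-1 vertices; their grid has
   n rows and n columns. *)
Definition CNAT (n : nat) : {set filling n n} :=
  [set T : filling n n |
    [&& nonambiguous T, complete T & #|T| == (2 * n - 1)%N]].

Definition filling_mx (m p : nat) (T : filling m p) : 'M[int]_(m, p) :=
  \matrix_(i < m, j < p) ((i, j) \in T)%:R.

Definition nb_CNAT_pos (n : nat) : nat :=
  #|[set T in CNAT n | \det (filling_mx T) == 1]|.

Definition nb_CNAT_neg (n : nat) : nat :=
  #|[set T in CNAT n | \det (filling_mx T) == -1]|.

Definition nb_CNAT (n : nat) : nat := #|CNAT n|.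

Definition diff_CNAT (n : nat) : int :=
  (nb_CNAT_pos n)%:Z - (nb_CNAT_neg n)%:Z.

(* Main.v *)
Require Import Defs.
From HB Require Import structures.
From mathcomp Require Import all_boot all_order all_algebra.
From mathcomp Require Import fingroup perm zify.
Set Implicit Arguments.
Unset Strict Implicit.
Unset Printing Implicit Defensive.
Import Order.TTheory GRing.Theory Num.Theory.
Local Open Scope ring_scope.

(** The matrix of a CNAT has determinant 1 or -1, so [D_n] is the sum of the
determinants.  Swapping two consecutive rows with no dotted column in common turns a
CNAT into a CNAT and changes the sign of its determinant.  Pair the rows, from the
bottom, as (n-2, n-1), (n-4, n-3), ..., and the columns likewise: all CNATs cancel
except the tight ones, in which any two paired rows share a dotted column and any two
paired columns share a dotted row.  In a tight CNAT the first vertex of the upper row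
of a pair and the top vertex of the left column of a pair are not leaves.  As only
n-1 vertices are not leaves, there is no tight CNAT when n > 1 is odd, and when
n = 2m every other vertex is a leaf.  The tight CNATs of size 2m are then exactly
those obtained from a CNAT of size m by giving two leaf children to each of its m
leaves.  Up to a simultaneous permutation of rows and columns their matrix is
[[M, P], [P, 0]] with P a permutation matrix, of determinant (-1)^m. *)

(** * Fillings as relations on natural numbers *)

(** Indices range over all natural numbers, with no dot outside the grid, so that successors, swaps
    and doubles of indices need no bound proofs. *)
Definition dot n (T : filling n n) (i j : nat) : bool :=
  [exists u in T, (u.1 == i :> nat)%N && (u.2 == j :> nat)%N].

Lemma dotE n (T : filling n n) (i j : 'I_n) : dot T i j = ((i, j) \in T).
Proof.
apply/exists_inP/idP => [[[a b] abT /= /andP[/eqP/val_inj <- /eqP/val_inj <-]] //|ijT].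
by exists (i, j); rewrite //= !eqxx.
Qed.

Lemma dot_mem n (T : filling n n) (u : cell n n) : (u \in T) = dot T u.1 u.2.
Proof. by rewrite dotE -surjective_pairing. Qed.

Lemma dot_lt n (T : filling n n) i j : dot T i j -> (i < n)%N && (j < n)%N.
Proof. by case/exists_inP => u _ /andP[/eqP <- /eqP <-]; rewrite !ltn_ord. Qed.

Lemma dotP n (T : filling n n) i j :
  dot T i j -> exists u : cell n n, [/\ u \in T, u.1 = i :> nat & u.2 = j :> nat].
Proof. by case/exists_inP => u uT /andP[/eqP ? /eqP ?]; exists u. Qed.

Lemma dot_inj n (T T' : filling n n) :
  (forall i j, (i < n)%N -> (j < n)%N -> dot T i j = dot T' i j) -> T = T'.
Proof. by move=> e; apply/setP => u; rewrite !dot_mem e. Qed.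

Definition fill n (d : nat -> nat -> bool) : filling n n :=
  [set u : cell n n | d u.1 u.2].

Lemma dot_fill n d i j : (i < n)%N -> (j < n)%N -> dot (fill n d) i j = d i j.
Proof.
by move=> hi hj; rewrite -[i]/(val (Ordinal hi)) -[j]/(val (Ordinal hj)) dotE inE.
Qed.

(** Completeness is encoded by the last two fields: a vertex has a child below exactly when some dot
    lies below it, and likewise on the right, so it has 0 or 2 children when both sides are occupied
    or neither is. The vertex count 2n - 1 is derived in [card_cnat], and [CNATP] gives the
    equivalence with [CNAT]. *)
Record cnat (n : nat) (d : nat -> nat -> bool) : Prop := Cnat {
  cnat_lt : forall i j, d i j -> (i < n)%N && (j < n)%N;
  cnat_root : d 0%N 0%N;
  cnat_row : forall i, (i < n)%N -> exists j, d i j;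
  cnat_col : forall j, (j < n)%N -> exists i, d i j;
  cnat_pred : forall i j, d i j -> (0 < i + j)%N ->
    (exists2 i', (i' < i)%N & d i' j) \/ (exists2 j', (j' < j)%N & d i j');
  cnat_excl : forall i j i' j',
    d i j -> d i' j -> (i' < i)%N -> d i j' -> (j' < j)%N -> False;
  cnat_down_right : forall i j i',
    d i j -> d i' j -> (i < i')%N -> exists2 j', (j < j')%N & d i j';
  cnat_right_down : forall i j j',
    d i j -> d i j' -> (j < j')%N -> exists2 i', (i < i')%N & d i' j }.

Lemma cnat_tr n d : cnat n d -> cnat n (fun i j => d j i).
Proof.
case=> h1 h2 h3 h4 h5 h6 h7 h8; split=> //.
- by move=> i j /h1; rewrite andbC.
- by move=> i j /h5 h; rewrite addnC => /h[]; [right|left].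
- by move=> i j i' j' dij di' lti dj' ltj; apply: (h6 j i j' i').
- by move=> i j i'; apply: h8.
- by move=> i j j'; apply: h7.
Qed.

Lemma eq_cnat n d d' : cnat n d -> (forall i j, d i j = d' i j) -> cnat n d'.
Proof.
case=> h1 h2 h3 h4 h5 h6 h7 h8 e; split.
- by move=> i j; rewrite -e => /h1.
- by rewrite -e.
- by move=> i /h3[j]; rewrite e; exists j.
- by move=> i /h4[j]; rewrite e; exists j.
- by move=> i j; rewrite -e => /h5 h /h[] [x lt]; rewrite e => dx; [left|right]; exists x.
- by move=> i j i' j'; rewrite -!e; apply: h6.
- by move=> i j i'; rewrite -!e => h h' /(h7 _ _ _ h h')[j']; rewrite e; exists j'.
- by move=> i j i'; rewrite -!e => h h' /(h8 _ _ _ h h')[j']; rewrite e; exists j'.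
Qed.

(** * Children and completeness *)

(** The dots after [u] form a chain, and [u] is the nearest precursor only of the first of them,
    which is the one with least coordinate sum. *)
Lemma card_nearest m p (r : rel (cell m p)) (T : filling m p) u :
    (forall v w, r v w -> (v.1 + v.2 < w.1 + w.2)%N) ->
    (forall v w, r u v -> r u w -> [|| v == w, r v w | r w v]) ->
  u \in T ->
  #|[set v in T | nearest r T u v]| = [exists v in T, r u v].
Proof.
move=> rlt rtot uT; have [/exists_inP[v0 v0T ruv0]|/exists_inPn nov] := boolP [exists v in T, r u v].
  case: (@arg_minnP _ v0 (fun v => (v \in T) && r u v) (fun v : cell m p => (v.1 + v.2)%N)).
    by rewrite v0T.
  move=> v /andP[vT ruv] vmin; apply/eqP/cards1P; exists v; apply/setP=> w.
  rewrite !inE /nearest uT /=; apply/idP/eqP => [/and3P[wT ruw /forall_inP near]|->].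
    case/or3P: (rtot _ _ ruv ruw) => [/eqP //|rvw|rwv].
      by move/negP: (near _ vT); rewrite ruv rvw.
    by have := vmin w; rewrite wT ruw => /(_ isT); rewrite leqNgt rlt.
  rewrite vT ruv; apply/forall_inP => x xT; apply/negP => /andP[rux rxv].
  by have := vmin x; rewrite xT rux => /(_ isT); rewrite leqNgt rlt.
apply/eqP; rewrite cards_eq0; apply/eqP/setP => v; rewrite !inE.
by apply/negP => /and4P[vT _ ruv _]; move/negP: (nov v vT).
Qed.

(** There is at most one child below and at most one on the right, and no child is of both kinds. *)
Lemma complete_vertex m p (T : filling m p) u : u \in T ->
  (#|children T u| == 0%N) || (#|children T u| == 2%N)
  = ([exists v in T, above u v] == [exists v in T, left_of u v]).
Proof.
move=> uT; have -> : children T u = [set v in T | nearest (@above m p) T u v]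
                     :|: [set v in T | nearest (@left_of m p) T u v].
  by apply/setP => v; rewrite !inE -andb_orr.
rewrite cardsU disjoint_setI0 ?cards0 ?subn0; last first.
  rewrite -setI_eq0; apply/eqP/setP => v; rewrite !inE; apply/negP.
  case/andP => /and4P[_ _ /andP[_ lt] _] /and4P[_ _ /andP[/eqP e _] _].
  by rewrite e ltnn in lt.
rewrite !card_nearest //; first by case: [exists _ in _, _]; case: [exists _ in _, _].
- by move=> v w /andP[/eqP -> ?]; rewrite ltn_add2l.
- move=> [a b] [a' b'] /andP[/= /eqP <- _] /andP[/= /eqP <- _].
  by rewrite /left_of /= eqxx xpair_eqE eqxx /= -val_eqE /=; case: ltngtP.
- by move=> v w /andP[/eqP -> ?]; rewrite ltn_add2r.
- move=> [a b] [a' b'] /andP[/= /eqP <- _] /andP[/= /eqP <- _].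
  by rewrite /above /= eqxx xpair_eqE eqxx andbT /= -val_eqE /=; case: ltngtP.
Qed.

(** Each fibre of [f] is totally ordered by [r], and its vertex of least [key] is the only one
    without predecessor. With rows or columns as fibres this counts first, topmost and last
    vertices. *)
Lemma card_extremal n (I : finType) (f : cell n n -> I) (key : cell n n -> nat)
    (r : rel (cell n n)) (T : filling n n) (A : {set I}) :
    (forall v u, r v u -> f v = f u) ->
    (forall v u, r v u -> (key v < key u)%N) ->
    (forall v u, f v = f u -> [|| v == u, r v u | r u v]) ->
    (forall i, i \in A -> exists2 u, u \in T & f u = i) ->
  #|[set u in T | (f u \in A) && ~~ [exists v in T, r v u]]| = #|A|.
Proof.
move=> rf rkey rtot rne; set X := [set u in T | _].
have finj : {in X &, injective f}.
  move=> u v; rewrite !inE => /and3P[uT _ /exists_inPn nu] /and3P[vT _ /exists_inPn nv] e.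
  case/or3P: (rtot _ _ e) => [/eqP //|h|h].
    by case/negP: (nv _ uT).
  by case/negP: (nu _ vT).
rewrite -(card_in_imset finj); apply: eq_card => i.
apply/imsetP/idP => [[u]|iA]; first by rewrite inE => /and3P[_ ? _] ->.
have [u0 u0T fu0] := rne i iA.
case: (@arg_minnP _ u0 (fun v => (v \in T) && (f v == i)) key).
  by rewrite u0T fu0 eqxx.
move=> u /andP[uT /eqP fu] umin; exists u => //; rewrite inE uT fu iA /=.
apply/exists_inPn => v vT; apply/negP => rvu.
have := umin v; rewrite vT (rf _ _ rvu) fu eqxx => /(_ isT).
by rewrite leqNgt rkey.
Qed.

Lemma has_aboveP n (T : filling n n) (v : cell n n) :
  reflect (exists2 i, (i < v.1)%N & dot T i v.2) [exists u in T, above u v].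
Proof.
apply: (iffP exists_inP) => [[u uT /andP[/eqP e lt]]|[i lt /dotP[u [uT e1 e2]]]].
  by exists u.1 => //; rewrite -e -dot_mem.
by exists u; rewrite // /above -val_eqE /= e2 eqxx e1.
Qed.

Lemma has_leftP n (T : filling n n) (v : cell n n) :
  reflect (exists2 j, (j < v.2)%N & dot T v.1 j) [exists u in T, left_of u v].
Proof.
apply: (iffP exists_inP) => [[u uT /andP[/eqP e lt]]|[i lt /dotP[u [uT e1 e2]]]].
  by exists u.2 => //; rewrite -e -dot_mem.
by exists u; rewrite // /left_of -val_eqE /= e1 eqxx e2.
Qed.

Lemma has_belowP n (T : filling n n) (u : cell n n) :
  reflect (exists2 i, (u.1 < i)%N & dot T i u.2) [exists v in T, above u v].
Proof.
apply: (iffP exists_inP) => [[v vT /andP[/eqP e lt]]|[i lt /dotP[v [vT e1 e2]]]].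
  by exists v.1 => //; rewrite e -dot_mem.
by exists v; rewrite // /above -val_eqE /= e2 eqxx e1.
Qed.

Lemma has_rightP n (T : filling n n) (u : cell n n) :
  reflect (exists2 j, (u.2 < j)%N & dot T u.1 j) [exists v in T, left_of u v].
Proof.
apply: (iffP exists_inP) => [[v vT /andP[/eqP e lt]]|[i lt /dotP[v [vT e1 e2]]]].
  by exists v.2 => //; rewrite e -dot_mem.
by exists v; rewrite // /left_of -val_eqE /= e1 eqxx e2.
Qed.

Lemma CNAT_cnat n (T : filling n n) : T \in CNAT n -> cnat n (dot T).
Proof.
rewrite inE => /and3P[/and4P[/exists_inP[r rT /andP[/eqP r1 /eqP r2]] /forall_inP pre
  /forallP row /forallP col] /forall_inP comp _].
have preP i j : dot T i j -> (0 < i + j)%N ->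
    exists v : cell n n, [/\ v.1 = i :> nat, v.2 = j :> nat &
      [exists u in T, above u v] (+) [exists u in T, left_of u v]].
  move=> /dotP[v [vT <- <-]] pos; exists v; split=> //.
  by have /implyP := pre v vT; apply; rewrite /is_root; lia.
have compP i j : dot T i j -> exists v : cell n n, [/\ v.1 = i :> nat, v.2 = j :> nat &
      [exists u in T, above v u] = [exists u in T, left_of v u]].
  move=> /dotP[v [vT <- <-]]; exists v; split=> //.
  exact: (eqP (etrans (esym (complete_vertex vT)) (comp v vT))).
split.
- exact: dot_lt.
- by move: rT; rewrite dot_mem r1 r2.
- move=> i hi; have /existsP[j ij] := row (Ordinal hi).
  by exists j; rewrite -[i]/(val (Ordinal hi)) dotE.
- move=> i hi; have /existsP[j ij] := col (Ordinal hi).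
  by exists j; rewrite -[i]/(val (Ordinal hi)) dotE.
- move=> i j dij /(preP _ _ dij)[v [<- <-]].
  by case: has_aboveP => [|_]; [left|case: has_leftP => [|//]; right].
- move=> i j i' j' dij di lti dj ltj.
  have [||v [e1 e2]] := preP i j => //; first by lia.
  case: has_aboveP => [_|[]]; last by exists i'; rewrite ?e1 ?e2.
  by case: has_leftP => [_|[]] //; exists j'; rewrite ?e1 ?e2.
- move=> i j i' dij di lti; have [v [e1 e2 e]] := compP i j dij.
  rewrite -e1 -e2; apply/has_rightP; rewrite -e; apply/has_belowP.
  by exists i'; rewrite ?e1 ?e2.
- move=> i j i' dij di lti; have [v [e1 e2 e]] := compP i j dij.
  rewrite -e1 -e2; apply/has_belowP; rewrite e; apply/has_rightP.
  by exists i'; rewrite ?e1 ?e2.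
Qed.

(** * Counting vertices, leaves and inner vertices *)

Lemma cnat_gt0 n d : cnat n d -> (0 < n)%N.
Proof. by move=> c; have /andP[] := cnat_lt c (cnat_root c). Qed.

Lemma cnat_row_in n (T : filling n n) : cnat n (dot T) ->
  forall i : 'I_n, exists2 u : cell n n, u \in T & u.1 = i.
Proof.
move=> c i; have [j /dotP[u [uT e _]]] := cnat_row c (ltn_ord i).
by exists u => //; apply: val_inj.
Qed.

Lemma cnat_col_in n (T : filling n n) : cnat n (dot T) ->
  forall i : 'I_n, exists2 u : cell n n, u \in T & u.2 = i.
Proof.
move=> c i; have [j /dotP[u [uT _ e]]] := cnat_col c (ltn_ord i).
by exists u => //; apply: val_inj.
Qed.

Definition leftmost n (T : filling n n) (A : {set 'I_n}) : filling n n :=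
  [set u in T | (u.1 \in A) && ~~ [exists v in T, left_of v u]].

Definition topmost n (T : filling n n) (A : {set 'I_n}) : filling n n :=
  [set u in T | (u.2 \in A) && ~~ [exists v in T, above v u]].

(** Testing the right side is enough in a CNAT, where dots on the right and dots below exist
    together. *)
Definition inner n (T : filling n n) : filling n n :=
  [set u in T | [exists v in T, left_of u v]].

Definition leaves n (T : filling n n) : filling n n := T :\: inner T.

Lemma card_leftmost n (T : filling n n) A :
  cnat n (dot T) -> #|leftmost T A| = #|A|.
Proof.
move=> c; apply: (card_extremal (key := fun u : cell n n => val u.2)).
- by move=> v u /andP[/eqP].
- by move=> v u /andP[].
- move=> [a b] [a' b'] /= ->; rewrite /left_of /= eqxx xpair_eqE eqxx /=.
  by rewrite -val_eqE /=; case: ltngtP.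
- by move=> i _; apply: cnat_row_in c i.
Qed.

Lemma card_topmost n (T : filling n n) A :
  cnat n (dot T) -> #|topmost T A| = #|A|.
Proof.
move=> c; apply: (card_extremal (key := fun u : cell n n => val u.1)).
- by move=> v u /andP[/eqP].
- by move=> v u /andP[].
- move=> [a b] [a' b'] /= ->; rewrite /above /= eqxx xpair_eqE eqxx andbT /=.
  by rewrite -val_eqE /=; case: ltngtP.
- by move=> i _; apply: cnat_col_in c i.
Qed.

Lemma card_leaves n (T : filling n n) :
  cnat n (dot T) -> #|leaves T| = n.
Proof.
move=> c; rewrite -[RHS]card_ord -cardsT.
(* The leaves are the last vertices of the rows: the order [left_of] and the column key are both
   reversed. *)
rewrite -(@card_extremal n _ fst (fun u => n - u.2)%N (fun v u => left_of u v) T setT).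
- by apply: eq_card => u; rewrite !inE /=; case: (u \in T); rewrite ?andbT.
- by move=> v u /andP[/eqP].
- by move=> [a b] [a' b'] /andP[_ /=]; have := ltn_ord b; lia.
- move=> [a b] [a' b'] /= ->; rewrite /left_of /= eqxx xpair_eqE eqxx /=.
  by rewrite -val_eqE /=; case: ltngtP.
- by move=> i _; apply: cnat_row_in c i.
Qed.

Lemma cnat_start_root n d i j : cnat n d -> d i j ->
  (forall i', (i' < i)%N -> ~ d i' j) -> (forall j', (j' < j)%N -> ~ d i j') ->
  i = 0%N /\ j = 0%N.
Proof.
move=> c dij ni nj; case: (posnP (i + j)) => [|/(cnat_pred c dij)]; first by lia.
by case=> [] [x lt dx]; [case: (ni x)|case: (nj x)].
Qed.

Lemma leftmost_topmost n (T : filling n n) A B u : cnat n (dot T) ->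
  u \in leftmost T A -> u \in topmost T B -> u.1 = 0%N :> nat /\ u.2 = 0%N :> nat.
Proof.
move=> c; rewrite !inE => /and3P[uT _ /has_leftP nl] /and3P[_ _ /has_aboveP na].
apply: (cnat_start_root c); first by rewrite -dot_mem.
  by move=> i lt di; case: na; exists i.
by move=> i lt di; case: nl; exists i.
Qed.

(** By [cnat_excl] every vertex is first in its row or topmost in its column, and only the root is
    both, which gives n + n - 1. *)
Lemma card_cnat n (T : filling n n) : cnat n (dot T) -> #|T| = (2 * n - 1)%N.
Proof.
move=> c; have n0 := cnat_gt0 c.
have eT : T = leftmost T setT :|: topmost T setT.
  apply/setP => u; rewrite !inE; case: (boolP (u \in T)) => //= uT.
  case: has_leftP => //= -[j ltj dj]; case: has_aboveP => //= -[i lti di].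
  by exfalso; apply: (cnat_excl c _ di lti dj ltj); rewrite -dot_mem.
pose o := Ordinal n0; rewrite eT cardsU card_leftmost // card_topmost //.
rewrite cardsT card_ord; suff -> : leftmost T setT :&: topmost T setT = [set (o, o)].
  by rewrite cards1; lia.
apply/setP => u; apply/idP/set1P => [/setIP[ul ut]|->].
  have [u1 u2] := leftmost_topmost c ul ut.
  by rewrite [u]surjective_pairing; congr (_, _); apply: val_inj.
rewrite !inE -dotE (cnat_root c) /=.
by apply/andP; split; apply/negP; [case/has_leftP|case/has_aboveP].
Qed.

Lemma card_inner n (T : filling n n) : cnat n (dot T) -> #|inner T| = n.-1.
Proof.
move=> c; have := cardsD T (inner T); rewrite -/(leaves T) card_leaves // (card_cnat c).
rewrite (setIidPr _); last by apply/subsetP => u; rewrite inE => /andP[].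
have := cnat_gt0 c; have : (#|inner T| <= #|T|)%N.
  by apply/subset_leq_card/subsetP => u; rewrite inE => /andP[].
by rewrite (card_cnat c); lia.
Qed.

Lemma CNATP n (T : filling n n) : reflect (cnat n (dot T)) (T \in CNAT n).
Proof.
apply: (iffP idP) => [|c]; first exact: CNAT_cnat.
have n0 := cnat_gt0 c; rewrite inE (card_cnat c) eqxx andbT.
apply/andP; split; last first.
  apply/forall_inP => u uT; have -> := complete_vertex uT; rewrite dot_mem in uT.
  apply/eqP; apply/has_belowP/has_rightP => -[x lt dx].
    exact: cnat_down_right c _ _ _ uT dx lt.
  exact: cnat_right_down c _ _ _ uT dx lt.
apply/and4P; split.
- have h : (Ordinal n0, Ordinal n0) \in T by rewrite -dotE; apply: cnat_root c.
  by apply/exists_inP; exists (Ordinal n0, Ordinal n0); rewrite // /is_root /= eqxx.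
- apply/forall_inP => u uT; apply/implyP; rewrite /is_root => nr.
  rewrite dot_mem in uT.
  case: has_aboveP => [[i lti di]|na]; case: has_leftP => [[j ltj dj]|nl] //.
    by case: (cnat_excl c uT di lti dj ltj).
  by case: (cnat_pred c uT); [lia| |].
- apply/forallP => i; have [[i' j] uT /= <-] := cnat_row_in c i.
  by apply/existsP; exists j.
- apply/forallP => j; have [[i j'] uT /= <-] := cnat_col_in c j.
  by apply/existsP; exists i.
Qed.

(** * Leaves and the determinant *)

Lemma leavesP n (T : filling n n) i j :
  reflect (dot T i j /\ forall j', (j < j')%N -> ~ dot T i j') (dot (leaves T) i j).
Proof.
apply: (iffP idP) => [/dotP[u []]|[/dotP[u [uT <- <-]] nr]].
  rewrite !inE => /andP[+ uT] <- <-; rewrite -dot_mem uT /= => /has_rightP nr; split=> //.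
  by move=> j' lt dj; apply: nr; exists j'.
by rewrite -dot_mem !inE uT andbT /=; apply/has_rightP => -[j' /nr].
Qed.

Lemma leaves_below n (T : filling n n) i j i' : cnat n (dot T) ->
  dot (leaves T) i j -> (i < i')%N -> ~ dot T i' j.
Proof.
move=> c /leavesP[dij nr] lt di'.
by have [j' /nr] := cnat_down_right c dij di' lt.
Qed.

Lemma leavesPb n (T : filling n n) i j : cnat n (dot T) ->
  dot T i j -> (forall i', (i < i')%N -> ~ dot T i' j) -> dot (leaves T) i j.
Proof.
move=> c dij nb; apply/leavesP; split=> // j' lt dj'.
by have [i' /nb] := cnat_right_down c dij dj' lt.
Qed.

Lemma row_last n d i : cnat n d -> (i < n)%N ->
  exists2 j, d i j & forall j', (j < j')%N -> ~ d i j'.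
Proof.
move=> c lt; have ex := cnat_row c lt.
have bd j : d i j -> (j <= n)%N by move/(cnat_lt c)/andP => [_ /ltnW].
case: (ex_maxnP ex bd) => j dij jmax; exists j => // j' ltj dj'.
by have := jmax _ dj'; rewrite leqNgt ltj.
Qed.

Lemma row_leaf n (T : filling n n) i : cnat n (dot T) -> (i < n)%N ->
  exists j, dot (leaves T) i j.
Proof. by move=> c /(row_last c)[j dij jmax]; exists j; apply/leavesP. Qed.

Lemma leaf_inj_row n (T : filling n n) i j j' :
  dot (leaves T) i j -> dot (leaves T) i j' -> j = j'.
Proof.
move=> /leavesP[d nr] /leavesP[d' nr']; case: (ltngtP j j') => // lt.
  by case: (nr _ lt).
by case: (nr' _ lt).
Qed.

Lemma leaf_inj_col n (T : filling n n) i i' j : cnat n (dot T) ->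
  dot (leaves T) i j -> dot (leaves T) i' j -> i = i'.
Proof.
move=> c l l'; have /leavesP[d _] := l; have /leavesP[d' _] := l'.
by case: (ltngtP i i') => // lt; [case: (leaves_below c l lt)|case: (leaves_below c l' lt)].
Qed.

(** The last dot of each row is its only leaf. A leaf is also the lowest dot of its column, so
    leaves of distinct rows lie in distinct columns. *)
Lemma leaf_perm n (T : filling n n) : cnat n (dot T) ->
  exists s : 'S_n, forall i j : 'I_n, ((i, j) \in leaves T) = (j == s i).
Proof.
move=> c; have ex (i : 'I_n) : exists j : 'I_n, (i, j) \in leaves T.
  have [j /[dup] /dot_lt/andP[_ lt]] := row_leaf c (ltn_ord i).
  by rewrite -[j]/(val (Ordinal lt)) dotE; exists (Ordinal lt).
have [f fP] := fin_all_exists ex.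
have finj : injective f.
  move=> i i' e; apply/val_inj/(leaf_inj_col (j := f i) c); rewrite dotE //.
  by rewrite e.
exists (perm finj) => i j; rewrite permE; apply/idP/eqP => [l|-> //].
by apply/val_inj/(leaf_inj_row (T := T) (i := i)); rewrite dotE.
Qed.

(* Once its columns are sorted by the rows of their leaves, the matrix is upper
   unitriangular, because the leaf of a column is its lowest dot. *)
Lemma det_cnat n (T : filling n n) : cnat n (dot T) ->
  (\det (filling_mx T) == 1) || (\det (filling_mx T) == -1).
Proof.
move=> c; have [s sP] := leaf_perm c.
have trig : is_trig_mx (col_perm s (filling_mx T))^T.
  apply/is_trig_mxP => i j lt; rewrite !mxE; case: (boolP ((j, s i) \in T)) => // h.
  have l : dot (leaves T) i (s i) by rewrite dotE sP.
  by case: (leaves_below c l lt); rewrite dotE.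
have := det_trig trig; rewrite big1 => [|i _]; last first.
  by rewrite !mxE; have := sP i (s i); rewrite eqxx inE => /andP[_ ->].
rewrite det_tr col_permE det_mulmx det_perm.
by case: (odd_perm _) => /=; rewrite ?mulr1 ?mulrN1; [move/eqP; rewrite eqr_oppLR => ->; rewrite orbT|move->; rewrite eqxx].
Qed.

Lemma nb_CNAT_split n : nb_CNAT n = (nb_CNAT_pos n + nb_CNAT_neg n)%N.
Proof.
rewrite /nb_CNAT /nb_CNAT_pos /nb_CNAT_neg.
rewrite -(cardsID [set T | \det (filling_mx T) == 1] (CNAT n)); congr (_ + _)%N.
  by apply: eq_card => T; rewrite !inE.
apply: eq_card => T; rewrite [RHS]inE [LHS]inE inE andbC.
have [/CNATP/det_cnat|//] := boolP (T \in CNAT n).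
by case/orP => /eqP ->.
Qed.

Lemma diff_CNAT_sum n :
  diff_CNAT n = \sum_(T : filling n n | T \in CNAT n) \det (filling_mx T).
Proof.
rewrite (bigID (fun T => \det (filling_mx T) == 1)) /=.
rewrite /diff_CNAT /nb_CNAT_pos /nb_CNAT_neg; congr (_ + _).
  rewrite (eq_bigr (fun=> 1)) => [|T /andP[_ /eqP] //].
  by rewrite sumr_const natz; congr Posz; apply: eq_card => T; rewrite inE unfold_in.
rewrite (eq_bigr (fun=> -1)) => [|T /andP[/CNATP/det_cnat/orP[->//|/eqP //]]].
rewrite sumr_const mulNrn natz; congr (- Posz _); apply: eq_card => T.
rewrite [LHS]inE [RHS]unfold_in /=; have [/CNATP/det_cnat|//] := boolP (T \in CNAT n).
by case/orP => /eqP ->.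
Qed.

(** * Swapping consecutive rows *)

Lemma row_start n d i : cnat n d -> (i < n)%N ->
  exists2 j, d i j & forall j', (j' < j)%N -> ~ d i j'.
Proof.
move=> c lt; case: (ex_minnP (cnat_row c lt)) => j dij jmin; exists j => // j' ltj /jmin.
by rewrite leqNgt ltj.
Qed.

(** The first dot of row 1 has nothing on its left, so its precursor lies above it, in row 0. *)
Lemma cnat_row01 n d : cnat n d -> (1 < n)%N -> exists j, d 0%N j && d 1%N j.
Proof.
move=> c lt; have [j dj jmin] := row_start c lt; exists j; rewrite dj andbT.
by case: (cnat_pred c dj) => // [[[|//] _ //]|[j' /jmin]].
Qed.

Definition sw (a i : nat) : nat :=
  if i == a then a.+1 else if i == a.+1 then a else i.

Lemma swK a : involutive (sw a).
Proof. by move=> i; rewrite /sw; do !case: eqP; lia. Qed.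

(** When rows a and a+1 share no dotted column, the swap preserves the vertical order of the dots
    within each column, and the tree conditions see only that order. The root row is not moved: by
    [cnat_row01], rows 0 and 1 always share a column. *)
Lemma cnat_sw n d a : cnat n d -> (a.+1 < n)%N ->
  (forall j, d a j -> d a.+1 j -> False) -> cnat n (fun i j => d (sw a i) j).
Proof.
move=> c lta disj.
have a0 : (0 < a)%N.
  case: a lta disj => // lt1 disj; have [j /andP[d0 d1]] := cnat_row01 c lt1.
  by case: (disj j).
have mono x y j : d x j -> d y j -> (x < y)%N -> (sw a x < sw a y)%N.
  move=> dx dy lt; have : ~ (x = a /\ y = a.+1).
    by move=> [ex ey]; apply: (disj j); rewrite -?ey -?ex.
  by rewrite /sw; do !case: eqP; lia.
have mono' x y j : d (sw a x) j -> d (sw a y) j -> (x < y)%N -> (sw a x < sw a y)%N.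
  move=> dx dy lt; case: (ltngtP (sw a x) (sw a y)) => // [lt'|e].
    by move: (mono _ _ _ dy dx lt'); rewrite !swK; lia.
  by move: lt; rewrite -(swK a x) e swK ltnn.
have sw0 : sw a 0 = 0%N by rewrite /sw; do !case: eqP; lia.
have swn i : (i < n)%N -> (sw a i < n)%N by rewrite /sw; do !case: eqP; lia.
split.
- by move=> i j /(cnat_lt c)/andP[/swn]; rewrite swK => -> ->.
- by rewrite sw0 (cnat_root c).
- by move=> i /swn /(cnat_row c).
- by move=> j /(cnat_col c)[i dij]; exists (sw a i); rewrite swK.
- move=> i j dij pos; case: (cnat_pred c dij) => [|[i' lt di']|]; last by right.
    by case: (posnP i) pos => [->|i0]; rewrite ?sw0 // /sw; do !case: eqP; lia.
  by left; exists (sw a i'); rewrite ?swK // -[i](swK a) (mono _ _ _ di' dij lt).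
- move=> i j i' j' dij di' lt dj' ltj.
  exact: (cnat_excl c dij di' (mono' _ _ _ di' dij lt) dj' ltj).
- move=> i j i' dij di' lt.
  exact: (cnat_down_right c dij di' (mono' _ _ _ dij di' lt)).
- move=> i j j' dij dj' lt; have [i' lti di'] := cnat_right_down c dij dj' lt.
  by exists (sw a i'); rewrite ?swK // -[i](swK a) (mono _ _ _ dij di' lti).
Qed.

Definition rsw n (a b : 'I_n) (T : filling n n) : filling n n :=
  [set u : cell n n | (tperm a b u.1, u.2) \in T].

Lemma rswK n (a b : 'I_n) : involutive (rsw a b).
Proof. by move=> T; apply/setP => u; rewrite !inE /= tpermK -surjective_pairing. Qed.

Lemma det_rsw n (a b : 'I_n) (T : filling n n) : a != b ->
  \det (filling_mx (rsw a b T)) = - \det (filling_mx T).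
Proof.
move=> ab; have -> : filling_mx (rsw a b T) = row_perm (tperm a b) (filling_mx T).
  by apply/matrixP => i j; rewrite !mxE inE.
by rewrite row_permE det_mulmx det_perm odd_tperm ab mulN1r.
Qed.

Lemma dot_rsw n (a b : 'I_n) (T : filling n n) i j :
  b = a.+1 :> nat -> dot (rsw a b T) i j = dot T (sw a i) j.
Proof.
move=> eb; have lta : (a.+1 < n)%N by rewrite -eb.
have swn k : (k < n)%N -> (sw a k < n)%N.
  by rewrite /sw; have := ltn_ord a; do !case: eqP; lia.
have [/andP[hi hj]|nlt] := boolP ((i < n) && (j < n))%N; last first.
  have -> : dot (rsw a b T) i j = false by apply: contraNF nlt => /dot_lt.
  by apply/esym; apply: contraNF nlt => /dot_lt/andP[/swn]; rewrite swK => -> ->.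
rewrite -[i]/(val (Ordinal hi)) -[j]/(val (Ordinal hj)); move: (Ordinal hi) (Ordinal hj).
move=> {hi hj i j} i j; rewrite dotE inE -dotE /=; congr dot; rewrite /sw.
case: tpermP => [-> | -> |] /=; rewrite ?eqxx //; first by rewrite eb; do !case: eqP; lia.
by move=> /eqP/negPf ni /eqP/negPf nj; rewrite -eb !(inj_eq val_inj) ni nj.
Qed.

(* For T in CNAT n, [radj T i] says that row i + 1 hangs from row i. *)
Definition radj n (T : filling n n) (i : nat) : bool :=
  [exists c : 'I_n, dot T i c && dot T i.+1 c].

Lemma radjP n (T : filling n n) i :
  reflect (exists c, dot T i c && dot T i.+1 c) (radj T i).
Proof.
apply: (iffP existsP) => [[c]|[c /andP[d /[dup]/dot_lt/andP[_ lt] d']]]; first by exists c.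
by exists (Ordinal lt); rewrite d d'.
Qed.

Lemma CNAT_rsw n (a b : 'I_n) (T : filling n n) : b = a.+1 :> nat ->
  ~~ radj T a -> T \in CNAT n -> rsw a b T \in CNAT n.
Proof.
move=> eb na /CNATP c; apply/CNATP.
apply: (@eq_cnat _ (fun i j => dot T (sw a i) j)) => [|i j]; last by rewrite dot_rsw.
apply: (cnat_sw c); first by rewrite -eb.
by move=> j d d'; case/negP: na; apply/radjP; exists j; rewrite d.
Qed.

(** * Transposition and cancellation *)

Definition trf n (T : filling n n) : filling n n := [set u : cell n n | (u.2, u.1) \in T].

Lemma trfK n : involutive (@trf n).
Proof. by move=> T; apply/setP => u; rewrite !inE -surjective_pairing. Qed.

Lemma dot_trf n (T : filling n n) i j : dot (trf T) i j = dot T j i.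
Proof.
apply/idP/idP => /dotP[u []]; rewrite dot_mem.
  by rewrite -dot_mem inE dot_mem => ? <- <-.
by move=> d <- <-; apply/exists_inP; exists (u.2, u.1); rewrite /= ?eqxx // inE dot_mem.
Qed.

Lemma CNAT_trf n (T : filling n n) : (trf T \in CNAT n) = (T \in CNAT n).
Proof.
by apply/CNATP/CNATP => /cnat_tr c; apply: eq_cnat c _ => i j; rewrite dot_trf.
Qed.

Lemma det_trf n (T : filling n n) : \det (filling_mx (trf T)) = \det (filling_mx T).
Proof.
by rewrite -det_tr; congr (\det _); apply/matrixP => i j; rewrite !mxE inE.
Qed.

(* The parity condition pairs the rows so that the last row is in a pair; the first
   row is left alone when n is odd. *)
Definition rows_ok n (k : nat) (T : filling n n) : bool :=
  [forall i : 'I_n, [&& i < k, odd i == odd n & i.+1 < n]%N ==> radj T i].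

Lemma rows_okP n k (T : filling n n) :
  reflect (forall i, (i < k)%N -> odd i = odd n -> (i.+1 < n)%N -> radj T i) (rows_ok k T).
Proof.
apply: (iffP forallP) => [h i ltk e lt|h i]; last first.
  by apply/implyP => /and3P[ltk /eqP e lt]; apply: h.
by have := h (Ordinal (ltnW lt)); rewrite /= ltk e eqxx lt.
Qed.

Lemma sum_sign_reversing (I : finType) (A : pred I) (f : I -> int) (phi : I -> I) :
  involutive phi -> (forall x, A x -> A (phi x)) -> (forall x, A x -> f (phi x) = - f x) ->
  \sum_(x | A x) f x = 0.
Proof.
move=> phiK phiA phif.
suff : \sum_(x | A x) f x = - \sum_(x | A x) f x by lia.
rewrite {1}(reindex_inj (inv_inj phiK)) -sumrN.
apply: eq_big => [x|x /phiA]; first by apply/idP/idP => /phiA; rewrite ?phiK.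
by rewrite phiK => /phif.
Qed.

Lemma radj_rsw n (a b : 'I_n) (T : filling n n) (i : nat) : b = a.+1 :> nat ->
  i <> a -> i <> a.+1 -> i.+1 <> a -> radj (rsw a b T) i = radj T i.
Proof.
move=> eb n1 n2 n3; apply: eq_existsb => c; rewrite !dot_rsw //.
by rewrite /sw; do !case: eqP => //; lia.
Qed.

(** The pairs are imposed one at a time: among the CNATs that satisfy the conditions below k, those
    whose rows k and k+1 share no column cancel under the swap of these rows. The predicate [Q] will
    carry the condition on columns. *)
Lemma sum_rows_ok n (Q : pred (filling n n)) (k : nat) :
    (forall (a b : 'I_n) T, b = a.+1 :> nat -> Q (rsw a b T) = Q T) ->
  \sum_(T | (T \in CNAT n) && Q T) \det (filling_mx T) =
  \sum_(T | (T \in CNAT n) && Q T && rows_ok k T) \det (filling_mx T).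
Proof.
move=> QI; elim: k => [|k IH].
  by apply: eq_bigl => T; rewrite [rows_ok _ _](introT (rows_okP _ _)) ?andbT.
rewrite IH; have okS (T : filling n n) :
    rows_ok k.+1 T = rows_ok k T && ((odd k == odd n) && (k.+1 < n)%N ==> radj T k).
  apply/rows_okP/andP => [h|[/rows_okP h /implyP hk] i].
    split; first by apply/rows_okP => i lt; apply: h; lia.
    by apply/implyP => /andP[/eqP e lt]; apply: h.
  rewrite ltnS leq_eqVlt => /orP[/eqP -> e lt|]; last exact: h.
  by apply: hk; rewrite e eqxx.
have [/andP[/eqP ek lt]|nk] := boolP ((odd k == odd n) && (k.+1 < n)%N); last first.
  by apply: eq_bigl => T; rewrite okS (negPf nk) andbT.
rewrite (bigID (fun T => radj T k)) /= [X in _ + X](_ : _ = 0) ?addr0.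
  by apply: eq_bigl => T; rewrite okS ek eqxx lt -!andbA.
pose a := Ordinal (ltnW lt); pose b := Ordinal lt.
have eb : b = a.+1 :> nat by [].
apply: (sum_sign_reversing (rswK a b)) => [T|T _]; last first.
  by apply: det_rsw; rewrite -val_eqE /=; lia.
move=> /andP[/andP[/andP[cT qT] /rows_okP rT] nT]; rewrite CNAT_rsw // QI //= qT /=.
apply/andP; split.
  (* As i < k have the same parity, i+1 differs from k, so the pair of rows i, i+1 is untouched by
     the swap. *)
  apply/rows_okP => i ltik ei lti; rewrite radj_rsw ?rT //=; try lia.
apply: (introN (radjP _ _)) => -[c]; rewrite !dot_rsw // => /andP[d1 d2].
case: (elimN (radjP _ _) nT); exists c.
case/negP: nT; apply/radjP; exists c.
by move: d1 d2; rewrite /sw /= !eqxx; case: eqP => [|_]; [lia|move=> -> ->].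
Qed.

Definition tight n (T : filling n n) : bool :=
  [&& T \in CNAT n, rows_ok n T & rows_ok n (trf T)].

(** The rows are treated first. Transposition turns their condition into one on columns, which row
    swaps preserve, so the rows can then be treated again. *)
Lemma sum_tight n :
  \sum_(T : filling n n | T \in CNAT n) \det (filling_mx T) =
  \sum_(T : filling n n | tight T) \det (filling_mx T).
Proof.
transitivity (\sum_(T : filling n n | (T \in CNAT n) && true) \det (filling_mx T)).
  by apply: eq_bigl => T; rewrite andbT.
rewrite (@sum_rows_ok n predT n) // (reindex_inj (inv_inj (@trfK n))) /=.
transitivity (\sum_(T : filling n n | (T \in CNAT n) && rows_ok n (trf T)) \det (filling_mx T)).
  by apply: eq_big => T; rewrite ?CNAT_trf ?andbT ?det_trf.
rewrite (@sum_rows_ok n (fun T => rows_ok n (trf T)) n) => [|a b T eb].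
  by apply: eq_bigl => T; rewrite /tight -andbA [rows_ok n T && _]andbC.
apply: eq_forallb => i; congr (_ ==> _).
(* The swap moves a row in which columns i and i+1 are both dotted from c to [sw a c]. *)
have imp (T' : filling n n) : radj (trf T') i -> radj (trf (rsw a b T')) i.
  case/radjP => c; rewrite !dot_trf => /andP[d1 d2]; apply/radjP; exists (sw a c).
  by rewrite !dot_trf !dot_rsw // swK d1.
by apply/idP/idP => /imp; rewrite ?rswK.
Qed.

(** * Counting inner vertices of tight CNATs *)

(** These are the upper rows, and the left columns, of the pairs. *)
Definition same_parity n : {set 'I_n} := [set i : 'I_n | odd i == odd n].

Lemma card_same_parity n : #|same_parity n| = n./2.
Proof.
rewrite cardsE -sum1_card big_mkcond /=.
have sum_odd b k : (\sum_(i < k) (if odd i == b then 1 else 0) =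
    if b then k./2 else uphalf k)%N.
  elim: k => [|k IH]; first by rewrite big_ord0; case: b.
  by rewrite big_ord_recr /= IH !uphalf_half {IH}; case: b; case: (odd k) => /=; lia.
by rewrite sum_odd uphalf_half; case: (odd n).
Qed.

Lemma tightP n (T : filling n n) :
  reflect [/\ cnat n (dot T),
    forall i, (i.+1 < n)%N -> odd i = odd n -> exists c, dot T i c && dot T i.+1 c &
    forall j, (j.+1 < n)%N -> odd j = odd n -> exists r, dot T r j && dot T r j.+1] (tight T).
Proof.
apply: (iffP and3P) => [[/CNATP c /rows_okP r1 /rows_okP r2]|[c r1 r2]].
  split=> // [i lt e|j lt e]; first by apply/radjP/r1 => //; apply: ltnW.
  have /radjP[r] : radj (trf T) j by apply: r2 => //; apply: ltnW.
  by rewrite !dot_trf; exists r.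
split; first exact/CNATP.
  by apply/rows_okP => i _ e lt; apply/radjP/r1.
by apply/rows_okP => i _ e lt; apply/radjP; have [r] := r2 i lt e; exists r; rewrite !dot_trf.
Qed.

Lemma same_parity_lt n (i : nat) : (i < n)%N -> odd i = odd n -> (i.+1 < n)%N.
Proof. by move=> lt e; rewrite ltn_neqAle lt andbT; apply: contra_eqN e => /eqP <- /=; case: odd. Qed.

(** The column shared with the next row is either to the right of the first vertex, or its own
    column. In the latter case there is a dot below it, hence one on its right. The version for
    columns is the mirror image. *)
Lemma leftmost_sub_inner n (T : filling n n) :
  tight T -> leftmost T (same_parity n) \subset inner T.
Proof.
move=> /tightP[c rok _]; apply/subsetP => u; rewrite !inE => /and3P[uT /eqP e /has_leftP nl].
rewrite uT; apply/has_rightP.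
have [j /andP[d1 d2]] := rok u.1 (same_parity_lt (ltn_ord _) e) e.
have [ltj|gtj|ej] := ltngtP u.2 j; first by exists j.
  by case: nl; exists j.
have [|j' lt d'] := cnat_down_right c d1 d2; first by [].
by exists j'; rewrite ?ej.
Qed.

Lemma topmost_sub_inner n (T : filling n n) :
  tight T -> topmost T (same_parity n) \subset inner T.
Proof.
move=> /tightP[c _ cok]; apply/subsetP => u; rewrite !inE => /and3P[uT /eqP e /has_aboveP na].
rewrite uT; apply/has_rightP.
have [r /andP[d1 d2]] := cok u.2 (same_parity_lt (ltn_ord _) e) e.
have [ltr|gtr|er] := ltngtP u.1 r.
- by rewrite dot_mem in uT; apply: (cnat_down_right c uT d1 ltr).
- by case: na; exists r.
- by exists u.2.+1; rewrite ?er.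
Qed.

(* Only n - 1 vertices are not leaves; the first vertices of the paired rows and
   columns, together with the root, are n of them. *)
Lemma tight_odd n (T : filling n n) : odd n -> (1 < n)%N -> ~~ tight T.
Proof.
move=> on lt1; apply/negP => tT; have /tightP[c _ _] := tT.
pose o := Ordinal (cnat_gt0 c); set L := leftmost T (same_parity n).
set P := topmost T (same_parity n).
have dLP : L :&: P = set0.
  apply/setP => u; rewrite in_set0; apply/negP => /setIP[uL uP].
  have [e _] := leftmost_topmost c uL uP.
  by move: uL; rewrite !inE e on /= andbF.
have oLP : (o, o) \notin L :|: P by rewrite !inE /= on /= !andbF.
have oin : (o, o) \in inner T.
  rewrite inE -dotE (cnat_root c); apply/has_rightP => /=.
  (* The top dot of column 1 has its precursor in column 0. If it lies in row 0 it is to the right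
     of the root; otherwise this precursor is below the root, and completeness gives a dot on the
     right. *)
  have [i di imin] := row_start (cnat_tr c) lt1.
  case: (cnat_pred c di) => [|[i' lt di']|[j' lt dj']]; [by lia|by case: (imin _ lt)|].
  have {lt dj'} di0 : dot T i 0 by case: j' lt dj'.
  have [i0|i0] := posnP i; first by move: di; rewrite i0; exists 1%N.
  exact: (cnat_down_right c (cnat_root c) di0 i0).
have : (#|(o, o) |: (L :|: P)| <= #|inner T|)%N.
  apply/subset_leq_card/subsetP => u /setU1P[-> //|/setUP[]]; apply/subsetP.
    exact: leftmost_sub_inner.
  exact: topmost_sub_inner.
rewrite cardsU1 oLP cardsU dLP cards0 card_leftmost // card_topmost // card_inner //.
by rewrite card_same_parity; have := odd_double_half n; rewrite on; lia.
Qed.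

(** Both sets lie in [inner T], have n/2 elements and meet at most in the root, so their union
    already has the n - 1 elements of [inner T]. *)
Lemma tight_even_inner n (T : filling n n) : ~~ odd n -> tight T ->
  inner T = leftmost T (same_parity n) :|: topmost T (same_parity n).
Proof.
move=> en tT; have /tightP[c _ _] := tT; apply/esym/eqP; rewrite eqEcard.
rewrite subUset leftmost_sub_inner // topmost_sub_inner //= card_inner //.
rewrite cardsU card_leftmost // card_topmost // card_same_parity.
suff : (#|leftmost T (same_parity n) :&: topmost T (same_parity n)| <= 1)%N.
  by have := odd_double_half n; rewrite (negPf en); lia.
pose o := Ordinal (cnat_gt0 c); rewrite -(cards1 (o, o)).
apply/subset_leq_card/subsetP => u /setIP[uL uP]; apply/set1P.
have [e1 e2] := leftmost_topmost c uL uP.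
by rewrite [u]surjective_pairing; congr (_, _); apply: val_inj.
Qed.

(** * Structure of tight CNATs of even size *)

(** The form in which tightness is used in size 2m. It is stable under transposition, so each fact
    on rows yields one on columns. *)
Record doubled (m : nat) (d : nat -> nat -> bool) : Prop := Doubled {
  dbl_cnat : cnat m.*2 d;
  dbl_row : forall i, (i < m)%N -> exists c, d i.*2 c && d i.*2.+1 c;
  dbl_col : forall j, (j < m)%N -> exists r, d r j.*2 && d r j.*2.+1;
  dbl_odd_row : forall i j j', odd i -> d i j -> d i j' -> j = j';
  dbl_odd_col : forall i i' j, odd j -> d i j -> d i' j -> i = i' }.

Lemma doubled_tr m d : doubled m d -> doubled m (fun i j => d j i).
Proof.
case=> c h1 h2 h3 h4; split=> //; first exact: cnat_tr.
  by move=> i j j'; apply: h4.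
by move=> i j j'; apply: h3.
Qed.

(** If the first dot of an odd row had a dot on its right, [tight_even_inner] would make it topmost
    in its column, hence the root, which is in row 0. So it is also the last dot of the row. Odd
    columns are similar. *)
Lemma tight_doubled m (T : filling m.*2 m.*2) : tight T -> doubled m (dot T).
Proof.
move=> tT; have /tightP[c rok cok] := tT.
have om : odd m.*2 = false by rewrite odd_double.
have ein := tight_even_inner (negbT om) tT.
split=> //.
- by move=> i lt; apply: rok; rewrite ?odd_double //; lia.
- by move=> i lt; apply: cok; rewrite ?odd_double //; lia.
- move=> i j j' oi d d'; have /andP[lti _] := cnat_lt c d.
  have [j0 dj0 jmin] := row_start c lti.
  have nr j1 : (j0 < j1)%N -> ~ dot T i j1.
    move=> lt dj1; have [u [uT e1 e2]] := dotP dj0.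
    have : u \in inner T by rewrite inE uT; apply/has_rightP; rewrite e1 e2; exists j1.
    rewrite ein !inE om e1 oi andbF /= => /and3P[_ ee /has_aboveP na].
    have [] := cnat_start_root c dj0 _ jmin; last by move=> i0; rewrite i0 in oi.
    by move=> i' lt' di'; apply: na; exists i'; rewrite ?e1 ?e2.
  have uniq j1 : dot T i j1 -> j1 = j0.
    by case: (ltngtP j1 j0) => // [/jmin|/nr].
  by rewrite (uniq j) // (uniq j').
- move=> i i' j oj d d'; have /andP[_ ltj] := cnat_lt c d.
  have [i0 di0 imin] := row_start (cnat_tr c) ltj.
  have nb i1 : (i0 < i1)%N -> ~ dot T i1 j.
    move=> lt di1; have [u [uT e1 e2]] := dotP di0.
    have [j1 ltj1 dj1] := cnat_down_right c di0 di1 lt.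
    have : u \in inner T by rewrite inE uT; apply/has_rightP; rewrite e1 e2; exists j1.
    rewrite ein !inE om e2 oj andbF orbF /= => /and3P[_ ee /has_leftP nl].
    have [] := cnat_start_root c di0 imin; last by move=> _ j0; rewrite j0 in oj.
    by move=> j' lt' dj'; apply: nl; exists j'; rewrite ?e1 ?e2.
  have uniq i1 : dot T i1 j -> i1 = i0.
    by case: (ltngtP i1 i0) => // [/imin|/nb].
  by rewrite (uniq i) // (uniq i').
Qed.

Lemma half_cases i : exists k, i = k.*2 \/ i = k.*2.+1.
Proof.
by exists i./2; have := odd_double_half i; case: (odd i) => /= e; [right|left]; rewrite -{1}e.
Qed.

Lemma doubled_odd_below m d i j i' :
  doubled m d -> odd i -> d i j -> (i < i')%N -> ~ d i' j.
Proof.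
move=> D oi dij lt di'; have [j' ltj dj'] := cnat_down_right (dbl_cnat D) dij di' lt.
by move: ltj; rewrite (dbl_odd_row D oi dij dj') ltnn.
Qed.

Lemma doubled_odd_right m d i j j' :
  doubled m d -> odd j -> d i j -> (j < j')%N -> ~ d i j'.
Proof. by move=> /doubled_tr D oj dij lt; apply: (doubled_odd_below D oj dij lt). Qed.

(** A dot alone in its row and in its column has no precursor, so it would be the root. *)
Lemma doubled_odd_even m d i j : doubled m d -> odd i -> d i j -> ~~ odd j.
Proof.
move=> D oi dij; apply/negP => oj.
have [||i0 _] := cnat_start_root (dbl_cnat D) dij; last by rewrite i0 in oi.
  by move=> i' lt di'; move: lt; rewrite (dbl_odd_col D oj dij di') ltnn.
by move=> j' lt dj'; move: lt; rewrite (dbl_odd_row D oi dij dj') ltnn.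
Qed.

(** The single dot of row 2i+1 must be the one in the column shared with row 2i. *)
Lemma doubled_up m d i j : doubled m d -> d i.*2.+1 j -> d i.*2 j.
Proof.
move=> D dij; have /andP[lti _] := cnat_lt (dbl_cnat D) dij.
have [|c /andP[dc dc']] := dbl_row D (i := i); first by lia.
by rewrite (dbl_odd_row D _ dij dc') //= odd_double.
Qed.

Lemma doubled_left m d i j : doubled m d -> d i j.*2.+1 -> d i j.*2.
Proof. by move=> /doubled_tr D dij; apply: (doubled_up D dij). Qed.

(** The shared column of rows 2i, 2i+1 and the shared row of columns 2j, 2j+1 cannot give precursors
    of (2i, 2j) both on the left and above, by [cnat_excl]; hence one of them gives a dot on the
    right or below. *)
Lemma doubled_inner m d i j : doubled m d -> d i.*2 j.*2 ->
  exists2 j', (j.*2 < j')%N & d i.*2 j'.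
Proof.
move=> D dij; have c := dbl_cnat D; have /andP[lti ltj] := cnat_lt c dij.
have [|c1 /andP[r1 r2]] := dbl_row D (i := i); first by lia.
have [|r /andP[c2 c3]] := dbl_col D (j := j); first by lia.
have [lt1|gt1|e1] := ltngtP c1 j.*2.
- have [lt2|gt2|e2] := ltngtP r i.*2.
  + by case: (cnat_excl c dij c2 lt2 r1 lt1).
  + exact: (cnat_down_right c dij c2 gt2).
  + by exists j.*2.+1; rewrite -?e2.
- by exists c1.
- by rewrite e1 in r2; apply: (cnat_down_right c dij r2).
Qed.

(* If the lower partner of (2i, 2j) were missing, the bottom leaf of column 2j would
   be the lower partner of a vertex (2i', 2j), i' > i, whose right partner is missing:
   the same defect, transposed, strictly further from the root. *)
Lemma doubled_pair m d i j : doubled m d -> d i.*2 j.*2.+1 -> d i.*2.+1 j.*2.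
Proof.
have [k le] : exists k, (m.*2 <= i + j + k)%N by exists m.*2; lia.
elim: k d i j le => [|k IH] d i j le D dij.
  by have /andP[] := cnat_lt (dbl_cnat D) dij; lia.
have c := dbl_cnat D; have dij0 := doubled_left D dij.
have [i1 lt1 di1] := cnat_right_down c dij0 dij (ltnSn _).
have /andP[_ ltj] := cnat_lt c dij0.
have [r dr rmax] := row_last (cnat_tr c) ltj.
have ltr : (i.*2 < r)%N by rewrite ltnNge; apply/negP => le'; apply: (rmax i1) => //; lia.
have [i' [er|er]] := half_cases r; rewrite {r}er in dr rmax ltr.
  have [j' ltj' dj'] := doubled_inner D dr.
  by have [r' /rmax] := cnat_right_down c dr dj' ltj'.
have dr' := doubled_up D dr.
have [<- //|ne] := eqVneq i' i.
(* The induction hypothesis puts a dot at (2i', 2j+1), but (2i, 2j+1) is the only dot of its odd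
   column. *)
have := IH _ j i' _ (doubled_tr D) dr => /(_ ltac:(lia)) d'.
have := dbl_odd_col D _ dij d'; rewrite /= odd_double => /(_ isT) e.
by move/eqP: ne; lia.
Qed.

Lemma doubled_pair_tr m d i j : doubled m d -> d i.*2.+1 j.*2 -> d i.*2 j.*2.+1.
Proof. by move=> /doubled_tr D dij; apply: (doubled_pair D dij). Qed.

(** The dots erased are leaves in odd rows or columns. By [doubled_pair] they go in sibling pairs,
    so each remaining vertex keeps both children or loses both. *)
Lemma doubled_half m d : doubled m d -> cnat m (fun i j => d i.*2 j.*2).
Proof.
move=> D; have c := dbl_cnat D.
have row i d' : doubled m d' -> (i < m)%N -> exists j, d' i.*2 j.*2.
  move=> D' lt; have [c1 /andP[r1 r2]] := dbl_row D' lt.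
  have := doubled_odd_even D' _ r2; rewrite /= odd_double => /(_ isT).
  by move=> /even_halfK e; exists c1./2; rewrite e.
have dr d' i j i' : doubled m d' -> d' i.*2 j.*2 -> d' i'.*2 j.*2 -> (i < i')%N ->
    exists2 j', (j < j')%N & d' i.*2 j'.*2.
  move=> D' dij di' lt; have [j1 lt1 dj1] := doubled_inner D' dij.
  have [j' [e|e]] := half_cases j1; rewrite {j1}e in lt1 dj1.
    by exists j' => //; lia.
  have dj' := doubled_left D' dj1; exists j' => //.
  rewrite ltn_neqAle; apply/andP; split; last by lia.
  (* Were the dot found at (2i, 2j+1), its sibling (2i+1, 2j), in an odd row, would have the dot
     (2i', 2j) below it. *)
  apply/eqP => e; rewrite -e in dj1; have d1 := doubled_pair D' dj1.
  by apply: (doubled_odd_below D' _ d1 _ di'); [rewrite /= odd_double|lia].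
split.
- by move=> i j /(cnat_lt c); lia.
- exact: cnat_root c.
- by move=> i; apply: row.
- by move=> j; apply: row (doubled_tr D).
- have up d' i j i' : doubled m d' -> d' i.*2 j.*2 -> d' i' j.*2 -> (i' < i.*2)%N ->
      exists2 i', (i' < i)%N & d' i'.*2 j.*2.
    move=> D' dij di' lt; have [k [e|e]] := half_cases i'; rewrite {i'}e in di' lt.
      by exists k => //; lia.
    by case: (doubled_odd_below D' _ di' lt dij); rewrite /= odd_double.
  move=> i j dij pos; case: (cnat_pred c dij) => [|[i' lt di']|[j' lt dj']]; first by lia.
    by left; apply: up D dij di' lt.
  by right; apply: (up _ j i j' (doubled_tr D)).
- move=> i j i' j' dij di' lti dj' ltj.
  by apply: (cnat_excl c dij di' _ dj'); lia.
- by move=> i j i' dij di' lt; apply: dr D dij di' lt.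
- by move=> i j j' dij dj' lt; apply: (dr _ j i j' (doubled_tr D)).
Qed.

(** * Doubling a CNAT *)

(* Row and column k of S become row and column 2k; the leaf (i, j) of S receives the
   children (2i + 1, 2j) and (2i, 2j + 1). *)
Definition double_dot m (S : filling m m) (i j : nat) : bool :=
  if odd i (+) odd j then dot (leaves S) i./2 j./2 else ~~ odd i && dot S i./2 j./2.

Lemma double_ee m (S : filling m m) i j : double_dot S i.*2 j.*2 = dot S i j.
Proof. by rewrite /double_dot !odd_double !doubleK. Qed.

Lemma double_oe m (S : filling m m) i j : double_dot S i.*2.+1 j.*2 = dot (leaves S) i j.
Proof. by rewrite /double_dot /= !odd_double /= uphalf_double doubleK. Qed.

Lemma double_eo m (S : filling m m) i j : double_dot S i.*2 j.*2.+1 = dot (leaves S) i j.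
Proof. by rewrite /double_dot /= !odd_double /= uphalf_double doubleK. Qed.

Lemma double_oo m (S : filling m m) i j : double_dot S i.*2.+1 j.*2.+1 = false.
Proof. by rewrite /double_dot /= !odd_double. Qed.

Definition double_dotE := (double_ee, double_oe, double_eo, double_oo).

Lemma leaves_dot m (S : filling m m) i j : dot (leaves S) i j -> dot S i j.
Proof. by case/leavesP. Qed.

Lemma leaves_right m (S : filling m m) i j j' :
  dot (leaves S) i j -> (j < j')%N -> ~ dot S i j'.
Proof. by case/leavesP => _; apply. Qed.

Lemma inner_right m (S : filling m m) i j : cnat m (dot S) -> dot S i j ->
  ~~ dot (leaves S) i j -> exists2 j', (j < j')%N & dot S i j'.
Proof.
move=> c dij nl; have /andP[lti _] := cnat_lt c dij.
have [j1 l1] := row_leaf c lti; exists j1; last exact: leaves_dot.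
case: (ltngtP j j1) => // [lt|e]; first by case: (leaves_right l1 lt).
by rewrite e l1 in nl.
Qed.

Lemma double_half m (S : filling m m) i j : double_dot S i j -> dot S i./2 j./2.
Proof. by rewrite /double_dot; case: ifP => _ => [/leaves_dot|/andP[]]. Qed.

(** Each leaf of [S] gains its two children together. Nothing lies to the right of these or below
    them, because a leaf of [S] is last in its row and lowest in its column. *)
Lemma cnat_double m (S : filling m m) : cnat m (dot S) -> cnat m.*2 (double_dot S).
Proof.
move=> c.
split.
- by move=> i j /double_half/(cnat_lt c); rewrite !ltn_half_double.
- by rewrite -[0%N]/(0.*2) double_ee (cnat_root c).
- move=> i; have [i0 [->|->]] := half_cases i => lt.
    by have [|j d] := cnat_row c (i := i0); [lia|exists j.*2; rewrite double_dotE].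
  by have [|j d] := row_leaf c (i := i0); [lia|exists j.*2; rewrite double_dotE].
- move=> j; have [j0 [->|->]] := half_cases j => lt.
    by have [|i d] := cnat_col c (j := j0); [lia|exists i.*2; rewrite double_dotE].
  have [|i d dmax] := row_last (cnat_tr c) (i := j0); first by lia.
  by exists i.*2; rewrite double_dotE; apply: leavesPb.
- move=> i j; have [i0 [->|->]] := half_cases i; have [j0 [->|->]] := half_cases j; rewrite double_dotE //.
  + move=> d pos; case: (cnat_pred c d) => [|[i' lt d']|[j' lt d']]; first by lia.
      by left; exists i'.*2; rewrite ?double_dotE //; lia.
    by right; exists j'.*2; rewrite ?double_dotE //; lia.
  + by move=> /leaves_dot d _; right; exists j0.*2; rewrite ?double_dotE.
  + by move=> /leaves_dot d _; left; exists i0.*2; rewrite ?double_dotE.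
- move=> i j i' j'; have [i0 [->|->]] := half_cases i; have [j0 [->|->]] := half_cases j;
  have [i1 [->|->]] := half_cases i'; have [j1 [->|->]] := half_cases j';
  rewrite !double_dotE // => d1 d2 lt1 d3 lt3.
  (* When i and j are even, the three dots project to an excluded configuration of [S]. Otherwise
     two distinct leaves of [S] would share a column or a row. *)
  1-4: by apply: (cnat_excl c d1 (i' := i1) (j' := j1)); first [lia | done | exact: leaves_dot].
  1,2: by have := leaf_inj_col c d1 d2; lia.
  1,2: by have := leaf_inj_row d1 d3; lia.
- move=> i j i'; have [i0 [->|->]] := half_cases i; have [j0 [->|->]] := half_cases j;
  have [i1 [->|->]] := half_cases i'; rewrite !double_dotE // => d1 d2 lt1.
  (* A leaf of [S] uses its new right child; an inner vertex keeps its dot on the right. *)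
  1,2: have [l|nl] := boolP (dot (leaves S) i0 j0);
    [by exists j0.*2.+1; rewrite ?double_dotE
    |by have [j1 lt d] := inner_right c d1 nl; exists j1.*2; rewrite ?double_dotE //; lia].
  + by have := leaf_inj_col c d1 d2; lia.
  + by case: (leaves_below (i' := i1) c d1) => //; lia.
  + by case: (leaves_below (i' := i1) c d1); [lia|apply: leaves_dot].
- move=> i j j'; have [i0 [->|->]] := half_cases i; have [j0 [->|->]] := half_cases j;
  have [j1 [->|->]] := half_cases j'; rewrite !double_dotE // => d1 d2 lt1.
  1,2: have [l|nl] := boolP (dot (leaves S) i0 j0);
    [by exists i0.*2.+1; rewrite ?double_dotE
    |have [j2 lt d] := inner_right c d1 nl; have [i2 lt' d'] := cnat_right_down c d1 d lt;
     by exists i2.*2; rewrite ?double_dotE //; lia].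
  + by case: (leaves_right (j' := j1) d1) => //; lia.
  + by case: (leaves_right (j' := j1) d1); [lia|apply: leaves_dot].
  + by have := leaf_inj_row d1 d2; lia.
Qed.

Definition dbl_fill m (S : filling m m) : filling m.*2 m.*2 := fill m.*2 (double_dot S).

Definition halve m (T : filling m.*2 m.*2) : filling m m :=
  fill m (fun i j => dot T i.*2 j.*2).

Lemma dot_dbl_fill m (S : filling m m) i j : dot (dbl_fill S) i j = double_dot S i j.
Proof.
have [/andP[hi hj]|nlt] := boolP ((i < m.*2) && (j < m.*2))%N; first exact: dot_fill.
have -> : dot (dbl_fill S) i j = false by apply: contraNF nlt => /dot_lt.
by apply/esym; apply: contraNF nlt => /double_half/dot_lt; rewrite !ltn_half_double.
Qed.

Lemma dot_halve m (T : filling m.*2 m.*2) i j : dot (halve T) i j = dot T i.*2 j.*2.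
Proof.
have [/andP[hi hj]|nlt] := boolP ((i < m) && (j < m))%N; first exact: dot_fill.
have -> : dot (halve T) i j = false by apply: contraNF nlt => /dot_lt.
by apply/esym; apply: contraNF nlt => /dot_lt; rewrite !ltn_double.
Qed.

Lemma dbl_fillK m : cancel (@dbl_fill m) (@halve m).
Proof. by move=> S; apply: dot_inj => i j _ _; rewrite dot_halve dot_dbl_fill double_ee. Qed.

(** The vertex (i, j) of [halve T] is a leaf exactly when (2i, 2j+1) is dotted in [T]: some dot lies
    to the right of (2i, 2j), and any such dot other than (2i, 2j+1) leaves a dot of [halve T] to
    the right of (i, j). *)
Lemma halveK m (T : filling m.*2 m.*2) : tight T -> dbl_fill (halve T) = T.
Proof.
move=> tT; have D := tight_doubled tT; have c := dbl_cnat D.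
have leafT i j : dot (leaves (halve T)) i j = dot T i.*2 j.*2.+1.
  apply/leavesP/idP => [[]|d]; rewrite dot_halve.
    move=> d nr; have [j' lt d'] := doubled_inner D d.
    have [k [e|e]] := half_cases j'; rewrite {j'}e in lt d'.
      by case: (nr k); [lia|rewrite dot_halve].
    have [<- //|/eqP ne] := eqVneq k j.
    by case: (nr k); [lia|rewrite dot_halve; apply: (doubled_left D)].
  split=> [|j' lt]; first exact: (doubled_left D).
  rewrite dot_halve; apply: (doubled_odd_right D _ d); last by lia.
  by rewrite /= odd_double.
apply: dot_inj => i j _ _; rewrite dot_dbl_fill.
have [i0 [->|->]] := half_cases i; have [j0 [->|->]] := half_cases j; rewrite double_dotE.
- by rewrite dot_halve.
- by rewrite leafT.
- by rewrite leafT; apply/idP/idP => [/(doubled_pair D)|/(doubled_pair_tr D)].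
- have [d|//] := boolP (dot T i0.*2.+1 j0.*2.+1); have := doubled_odd_even D _ d.
  by rewrite /= !odd_double => /(_ isT).
Qed.

Lemma halve_CNAT m (T : filling m.*2 m.*2) : tight T -> halve T \in CNAT m.
Proof.
move=> tT; apply/CNATP; apply: eq_cnat (doubled_half (tight_doubled tT)) _ => i j.
by rewrite dot_halve.
Qed.

Lemma tight_dbl_fill m (S : filling m m) : S \in CNAT m -> tight (dbl_fill S).
Proof.
move=> /CNATP c; apply/tightP; split.
- by apply: eq_cnat (cnat_double c) _ => i j; rewrite dot_dbl_fill.
- move=> i; rewrite odd_double; have [i0 [->|->]] := half_cases i; rewrite /= ?odd_double // => lt _.
  have [|j l] := row_leaf c (i := i0); first by lia.
  by exists j.*2; rewrite !dot_dbl_fill !double_dotE leaves_dot.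
- move=> j; rewrite odd_double; have [j0 [->|->]] := half_cases j; rewrite /= ?odd_double // => lt _.
  have [|i d dmax] := row_last (cnat_tr c) (i := j0); first by lia.
  by exists i.*2; rewrite !dot_dbl_fill !double_dotE d; apply: leavesPb.
Qed.

Lemma big_tight m (f : filling m.*2 m.*2 -> int) :
  \sum_(T | tight T) f T = \sum_(S in CNAT m) f (dbl_fill S).
Proof.
rewrite (reindex_onto (@dbl_fill m) (@halve m)) => [|T]; last exact: halveK.
apply: eq_bigl => S; rewrite dbl_fillK eqxx andbT; apply/idP/idP => [/halve_CNAT|].
  by rewrite dbl_fillK.
exact: tight_dbl_fill.
Qed.

(** * Determinant of a doubled CNAT *)

(** The signs of the row and column permutations cancel. Two sizes occur because it relates the
    block size m + m to [m.*2]. *)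
Lemma det_mxsub_inj (R : comNzRingType) n1 n2 (f : 'I_n1 -> 'I_n2) (A : 'M[R]_n2) :
  n1 = n2 -> injective f -> \det (mxsub f f A) = \det A.
Proof.
move=> e; case: _ / e in f A * => finj.
have -> : mxsub f f A = row_perm (perm finj) (col_perm (perm finj) A).
  by apply/matrixP => i j; rewrite !mxE !permE.
rewrite row_permE col_permE !det_mulmx !det_perm odd_permV mulrCA.
by rewrite -signr_addb addbb mulr1.
Qed.

(** Multiplication by the block swap [J] gives [[P, M], [0, P]], whose determinant is the square of
    a sign. *)
Lemma det_antidiag_block (R : comNzRingType) m (M : 'M[R]_m) (s : 'S_m) :
  \det (block_mx M (perm_mx s) (perm_mx s) 0) = (-1) ^+ m.
Proof.
set P := perm_mx s; pose J : 'M[R]_(m + m) := block_mx 0 1%:M 1%:M 0.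
have detJ : \det J = (-1) ^+ m.
  (* Two block row operations of determinant 1 turn [J] into [[1, 1], [0, -1]]. *)
  have : \det (block_mx 1%:M 0 (- 1%:M) 1%:M *m (block_mx 1%:M 1%:M 0 1%:M *m J)) = (-1) ^+ m.
    rewrite /J !mulmx_block !mul0mx !mulmx0 !mulmx1 !mul1mx !add0r !addr0.
    by rewrite !mulNmx !mul1mx addNr det_ublock det1 mul1r -scaleN1r detZ det1 mulr1.
  by rewrite !det_mulmx det_lblock det_ublock !det1 !mul1r.
have : \det (block_mx M P P 0 *m J) = 1.
  rewrite /J mulmx_block !mulmx0 !mulmx1 !add0r !addr0 det_ublock det_perm.
  by rewrite -signr_addb addbb.
rewrite det_mulmx detJ => /(congr1 ( *%R^~ ((-1) ^+ m))).
by rewrite -mulrA -expr2 sqrr_sign mulr1 mul1r.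
Qed.

(* Even indices first, then odd ones. *)
Definition unshuffle m (u : 'I_(m + m)) : nat :=
  match split u with inl i => i.*2 | inr i => i.*2.+1 end.

Lemma unshuffle_lt m (u : 'I_(m + m)) : (unshuffle u < m.*2)%N.
Proof. by rewrite /unshuffle; case: split => i; have := ltn_ord i; lia. Qed.

Lemma unshuffle_l m (i : 'I_m) : unshuffle (lshift m i) = i.*2.
Proof. by rewrite /unshuffle (unsplitK (inl i)). Qed.

Lemma unshuffle_r m (i : 'I_m) : unshuffle (rshift m i) = i.*2.+1.
Proof. by rewrite /unshuffle (unsplitK (inr i)). Qed.

(** Each leaf (i, j) of [S] puts a 1 at position (i, j) of both off-diagonal blocks, so both are the
    matrix of the leaf permutation. *)
Lemma det_dbl_fill m (S : filling m m) : S \in CNAT m ->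
  \det (filling_mx (dbl_fill S)) = (-1) ^+ m.
Proof.
move=> /CNATP c; have [s sP] := leaf_perm c.
pose f (u : 'I_(m + m)) := Ordinal (unshuffle_lt u).
have finj : injective f.
  move=> u v /(congr1 val) /=; have [i ->|i ->] := split_ordP u; have [j ->|j ->] := split_ordP v;
  rewrite ?unshuffle_l ?unshuffle_r => e; try lia; congr (_ _ _); apply: val_inj => /=; lia.
rewrite -(det_mxsub_inj _ (addnn m) finj) -(det_antidiag_block (filling_mx S) s).
congr (\det _); apply/matrixP => u v; rewrite [LHS]mxE [LHS]mxE dot_mem dot_dbl_fill /=.
have leafE (i j : 'I_m) : dot (leaves S) i j = (s i == j) by rewrite dotE sP eq_sym.
have [i ->|i ->] := split_ordP u; have [j ->|j ->] := split_ordP v;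
  rewrite ?unshuffle_l ?unshuffle_r double_dotE.
- by rewrite block_mxEul mxE dotE.
- by rewrite block_mxEur !mxE leafE.
- by rewrite block_mxEdl !mxE leafE.
- by rewrite block_mxEdr mxE.
Qed.

Lemma sum_tight_double m :
  \sum_(T : filling m.*2 m.*2 | tight T) \det (filling_mx T) = (-1) ^+ m * (nb_CNAT m)%:Z.
Proof.
rewrite big_tight (eq_bigr (fun=> (-1) ^+ m)) => [|S]; last exact: det_dbl_fill.
by rewrite sumr_const -mulr_natr natz.
Qed.

Lemma sum_tight_odd n : odd n -> (1 < n)%N ->
  \sum_(T : filling n n | tight T) \det (filling_mx T) = 0.
Proof. by move=> on lt; apply: big_pred0 => T; apply/negbTE/tight_odd. Qed.

(** * Size one and the final formula *)

Lemma CNAT1 : CNAT 1 = [set setT].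
Proof.
have dT (T : filling 1 1) : dot T 0 0 -> T = setT.
  move=> d; apply/setP => u; rewrite [u]surjective_pairing !ord1 -dotE inE; exact: d.
apply/setP => T; apply/idP/set1P => [/CNAT_cnat/cnat_root/dT //|->].
have d1 i j : ((i < 1) && (j < 1))%N = dot [set: cell 1 1] i j.
  apply/idP/idP => [|/dot_lt //]; case: i j => [|i] [|j] // _.
  by apply/exists_inP; exists (ord0, ord0).
apply/CNATP; apply: eq_cnat d1; split=> //.
- by move=> i lt; exists 0%N; rewrite lt.
- by move=> j lt; exists 0%N; rewrite lt.
- by move=> i j; lia.
- by move=> i j i' j'; lia.
- by move=> i j i'; lia.
- by move=> i j j'; lia.
Qed.

Lemma diff_CNAT1 : diff_CNAT 1 = 1.
Proof. by rewrite diff_CNAT_sum CNAT1 big_set1 det_mx11 mxE inE. Qed.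

Theorem mainTheorem1 (n : nat) (hn : (1 <= n)%N) :
  nb_CNAT n = (nb_CNAT_pos n + nb_CNAT_neg n)%N /\
  diff_CNAT n =
    (if n == 1%N then 1
     else if odd n then 0
     else (-1) ^+ (n./2) * (nb_CNAT (n./2))%:Z).
Proof.
split; first exact: nb_CNAT_split.
have [->|n1] := eqVneq n 1%N; first exact: diff_CNAT1.
rewrite diff_CNAT_sum sum_tight; have [on|en] := boolP (odd n).
  by rewrite sum_tight_odd //; lia.
move: n./2 (even_halfK en) => m em; rewrite -{}em in n1 hn en *.
exact: sum_tight_double.
Qed.
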